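(* Let $1<p\leqslant2$, let $0<\varepsilon\leqslant1$, and set $c=c(\varepsilon,p)\coloneqq\frac14\,\varepsilon^{\frac{2(p+1)}{p}}(p-1)$. Let $n,d$ be positive integers with $n\geqslant 2d/c$, and let $\boldsymbol{X}$ be a dissociated, $d$-dimensional random array on $[n]$ whose entries take values in a measurable space $\mathcal{X}$. Then for every measurable $f\colon\mathcal{X}^{\binom{[n]}{d}}\to\mathbb{R}$ with $\mathbb{E}[f(\boldsymbol{X})]=0$ and $\|f(\boldsymbol{X})\|_{L_p}=1$ there exists an interval $I$ of $[n]$ with $|I|\geqslant cn$ such that for every $J\subseteq I$ with $|J|\geqslant d$, \[ \mathbb{P}\big(\big|\mathbb{E}[f(\boldsymbol{X})\,|\,\mathcal{F}_J]\big|\leqslant\varepsilon\big)\geqslant1-\varepsilon. \]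
   Context: $[n]=\{1,\dots,n\}$, $\binom{I}{d}$ is the set of $d$-element subsets of $I$. A $d$-dimensional random array on $[n]$ is a process $\boldsymbol{X}=\langle X_s:s\in\binom{[n]}{d}\rangle$; for $J\subseteq[n]$ with $|J|\geqslant d$, $\mathcal{F}_J=\sigma(\{X_s:s\in\binom{J}{d}\})$. $\boldsymbol{X}$ is dissociated if for every $J,K\subseteq[n]$ with $|J|,|K|\geqslant d$ and $\max(J)<\min(K)$ the $\sigma$-algebras $\mathcal{F}_J$ and $\mathcal{F}_K$ are independent. An interval of $[n]$ is a set of consecutive integers. *)

(* Defs.v *)
From HB Require Import structures.
From mathcomp Require Import all_boot all_order all_algebra.
From mathcomp Require Import all_classical all_reals all_analysis.
Set Implicit Arguments. Unset Strict Implicit. Unset Printing Implicit Defensive.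
Import Order.TTheory GRing.Theory Num.Theory.
Local Open Scope classical_set_scope.
Local Open Scope ring_scope.

Definition dsub (n d : nat) := {s : {set 'I_n} | #|s| == d}.

Definition prod_sigma {dX} (X : measurableType dX) (I : finType) :
    set (set (I -> X)) :=
  <<s \bigcup_(i in [set: I]) preimage_set_system setT (fun x : I -> X => x i) measurable >>.

Definition prod_measurable {dX} (X : measurableType dX) (I : finType)
    (R : realType) (f : (I -> X) -> R) : Prop :=
  forall B : set R, measurable B -> @prod_sigma _ X I (f @^-1` B).

Definition sigmaJ {dT dX} {T : measurableType dT} {X : measurableType dX}
    (n d : nat) (Xa : dsub n d -> T -> X) (J : {set 'I_n}) : set (set T) :=
  <<s \bigcup_(s in [set s : dsub n d | val s \subset J])
        preimage_set_system setT (Xa s) measurable >>.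

Definition indep_sets {dT} {T : measurableType dT} {R : realType}
    (P : probability T R) (F G : set (set T)) : Prop :=
  forall A B, F A -> G B -> P (A `&` B) = (P A * P B)%E.

Definition dissociated {dT dX} {T : measurableType dT} {X : measurableType dX}
    {R : realType} (P : probability T R) (n d : nat) (Xa : dsub n d -> T -> X) : Prop :=
  forall J K : {set 'I_n}, (d <= #|J|)%N -> (d <= #|K|)%N ->
    (forall j k, j \in J -> k \in K -> (j < k)%N) ->
    indep_sets P (sigmaJ Xa J) (sigmaJ Xa K).

Definition nat_interval (n : nat) (I : {set 'I_n}) : Prop :=
  forall i j k : 'I_n, i \in I -> k \in I -> (i <= j)%N -> (j <= k)%N -> j \in I.

Definition is_cond_exp {dT} {T : measurableType dT} {R : realType}
    (P : probability T R) (G : set (set T)) (Y Z : T -> R) : Prop :=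
  [/\ (forall B : set R, measurable B -> G (Z @^-1` B)),
      P.-integrable setT (EFin \o Z)
    & forall A, G A -> (\int[P]_(x in A) (Z x)%:E = \int[P]_(x in A) (Y x)%:E)%E].

(* Main.v *)
Require Import Defs.
From HB Require Import structures.
From mathcomp Require Import all_boot all_order all_algebra.
From mathcomp Require Import all_classical all_reals all_analysis.
From mathcomp Require Import measurable_realfun ring lra.
Import Order.TTheory GRing.Theory Num.Theory.
Import numFieldNormedType.Exports.
Local Open Scope classical_set_scope.
Local Open Scope ring_scope.
Set Implicit Arguments. Unset Strict Implicit. Unset Printing Implicit Defensive.

(** Cut an initial segment of [n] into m consecutive blocks I_0, ..., I_(m-1)
    of equal length, let x_k = E[f(X) | F_(I_0 u ... u I_(k-1))] and
    d_k = x_(k+1) - x_k.  By the 2-uniform convexity of L_p the martingale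
    inequality ||x + d||^2 >= ||x||^2 + (p - 1) ||d||^2 holds whenever
    E[d | G] = 0 and x is G-measurable, so (p - 1) sum_k ||d_k||^2 <= 1 and some
    d_k has small norm.  Since X is dissociated, F_(I_k) is independent of x_k,
    which has mean 0; hence E[f(X) | F_J] = E[d_k | F_J] for every J included in
    I_k, and this is controlled by ||d_k|| and Markov's inequality. *)

(** * Inequalities for real powers *)

Section scalar.
Context {R : realType}.
Implicit Types (p q r x y a b u v w : R).

(** The exponent of [eps] in [c] is dictated by Markov's inequality: a probability of at most eps
    for |Z| > eps calls for a p-th moment of at most eps^(p+1), that is, a squared L_p norm of at
    most eps^(2(p+1)/p). With at least 1/(4c) blocks the smallest increment meets this bound, the
    factor p - 1 of [c] cancelling the convexity constant. One increment serves all J at once,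
    because conditioning it on F_J only decreases its norm. For p < 2 there is no Pythagorean
    identity in L_p. Its substitute starts from a two-point inequality for real numbers, which is
    integrated and then iterated over ever smaller multiples of the increment. Initial segments are
    used for the filtration because dissociativity compares only index sets lying one before the
    other. *)

Lemma powR_young p u v : 1 < p -> 0 <= u -> 0 <= v ->
  p * (u * v `^ (p - 1)) <= u `^ p + (p - 1) * v `^ p.
Proof.
move=> p1 u0 v0.
have p0 : 0 < p by lra.
have pN : p != 0 by rewrite gt_eqF.
have p1N : p - 1 != 0 by rewrite gt_eqF//; lra.
(* Young's inequality for [u] and v^(p-1) with exponents p and p/(p-1). Cleared of denominators it
   is the tangent line of r^p at [v], to which Bernoulli's inequality and midpoint convexity are
   reduced below. *)
have := @conjugate_powR R u (v `^ (p - 1)) p (p / (p - 1)) u0 (powR_ge0 _ _) p0.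
rewrite -powRrM.
have -> : (p - 1) * (p / (p - 1)) = p by field.
have q0 : 0 < p / (p - 1) by rewrite divr_gt0//; lra.
have e : p^-1 + (p / (p - 1))^-1 = 1 by field; rewrite pN p1N.
move=> /(_ q0 e) h.
have := ler_wpM2l (ltW p0) h.
by have -> : p * (u `^ p / p + v `^ p / (p / (p - 1))) = u `^ p + (p - 1) * v `^ p by field; rewrite pN p1N.
Qed.

(** Young's inequality at |x + w| and |x|, combined with sg(x)(x + w) <= |x + w|. Conditional Jensen
    is obtained by integrating this tangent line. *)
Lemma powR_norm_tangent p x w : 1 < p ->
  `|x| `^ p + p * (Num.sg x * `|x| `^ (p - 1)) * w <= `|x + w| `^ p.
Proof.
move=> p1.
have p0 : 0 < p by lra.
have := powR_young p1 (normr_ge0 (x + w)) (normr_ge0 x).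
have e : `|x| * `|x| `^ (p - 1) = `|x| `^ p by rewrite mulr_powRB1.
have h : Num.sg x * (x + w) * `|x| `^ (p - 1) <= `|x + w| * `|x| `^ (p - 1).
  apply: ler_wpM2r; first exact: powR_ge0.
  apply: le_trans (ler_norm _) _; rewrite normrM normr_sg.
  by case: (x != 0); rewrite ?mul1r ?mul0r.
have h2 : Num.sg x * (x + w) * `|x| `^ (p - 1) =
    `|x| `^ p + (Num.sg x * `|x| `^ (p - 1)) * w.
  by rewrite mulrDr -normrEsg mulrDl e mulrAC.
rewrite h2 in h.
have := ler_wpM2l (ltW p0) h; lra.
Qed.

(** Young's inequality with exponent 1/r, applied to (1 + x)^r and 1. *)
Lemma powR_bernoulli r x : 0 < r <= 1 -> 0 <= x -> (1 + x) `^ r <= 1 + r * x.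
Proof.
move=> /andP[r0 r1] x0.
have [->|rN1] := eqVneq r 1; first by rewrite powRr1 ?mul1r//; lra.
have q1 : 1 < r^-1 by rewrite invf_gt1// lt_neqAle rN1.
have := powR_young q1 (powR_ge0 (1 + x) r) ler01.
rewrite powR1 !mulr1 -powRrM mulfV ?gt_eqF// powRr1; last lra.
move=> h; have := ler_wpM2l (ltW r0) h.
rewrite mulrA mulfV ?gt_eqF// mul1r mulrDr mulrBr mulfV ?gt_eqF//; lra.
Qed.

Lemma derive_ge0_ge0 (f df : R -> R) b : 0 <= b -> f 0 = 0 ->
  (forall x, 0 <= x <= b -> is_derive x 1 f (df x)) ->
  (forall x, 0 <= x <= b -> 0 <= df x) -> 0 <= f b.
Proof.
move=> b0 f0 fd dge0.
have fd' x : x \in `]0, b[ -> is_derive x 1 f (df x).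
  by rewrite in_itv/= => /andP[x0 xb]; apply: fd; rewrite !ltW.
have fc : {within `[0, b], continuous f}.
  apply: derivable_within_continuous => x.
  by rewrite in_itv/= => xb; have [] := fd x xb.
have [c] := MVT_segment b0 fd' fc.
rewrite in_itv/= f0 !subr0 => cb ->.
by rewrite mulr_ge0// dge0.
Qed.

(** Up to the factor p, this compares the derivatives of the two sides of [powR_two_point_lt1]. The
    condition y < 1 keeps 1 - y where the power is differentiable. *)
Lemma powR_add_sub_ge p y : 1 < p -> p <= 2 -> 0 <= y -> y < 1 ->
  2 * (p - 1) * y <= (1 + y) `^ (p - 1) - (1 - y) `^ (p - 1).
Proof.
move=> p1 p2 y0 y1; rewrite -subr_ge0.
pose f (x : R) := (1 + x) `^ (p - 1) - (1 - x) `^ (p - 1) - 2 * (p - 1) * x.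
pose df (x : R) := (p - 1) * (1 + x) `^ (p - 1 - 1) +
  (p - 1) * (1 - x) `^ (p - 1 - 1) - 2 * (p - 1).
apply: (@derive_ge0_ge0 f df) => //.
- by rewrite /f addr0 subr0 mulr0 subr0 subrr.
- move=> x /andP[x0 xy].
  have i1 : 0 < 1 + x by lra.
  have i2 : 0 < 1 - x by lra.
  have g1 : is_derive x 1 (fun z : R => 1 + z) (0 + 1) by exact: is_deriveD.
  have g2 : is_derive x 1 (fun z : R => 1 - z) (0 - 1) by exact: is_deriveB.
  have h1 := @is_derive1_comp _ (fun z => z `^ (p - 1)) (fun z : R => 1 + z)
    x _ _ (is_derive1_powR _ i1) g1.
  have h2 := @is_derive1_comp _ (fun z => z `^ (p - 1)) (fun z : R => 1 - z)
    x _ _ (is_derive1_powR _ i2) g2.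
  rewrite /f /df; apply: is_derive_eq.
  rewrite /GRing.scale/=; ring.
- move=> x /andP[x0 xy]; rewrite /df.
  set a := _ `^ _; set b := (1 - x) `^ _.
  have a0 : 0 < a by rewrite powR_gt0//; lra.
  have b0 : 0 < b by rewrite powR_gt0//; lra.
  (* The product is (1 - x^2)^(p-2) with a nonpositive exponent; the arithmetic-geometric mean
     inequality then gives a + b >= 2. *)
  have ab : 1 <= a * b.
    rewrite /a /b -powRM; [|lra|lra].
    have i : 0 < (1 + x) * (1 - x) <= 1 by apply/andP; split; nra.
    by rewrite -[leLHS](powRr0 ((1 + x) * (1 - x))) (ger_powR i)//; lra.
  have ab2 : 2 <= a + b.
    rewrite -(@ler_pXn2r _ 2)// ?nnegrE; [|lra..].
    by have := sqr_ge0 (a - b); lra.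
  have -> : (p - 1) * a + (p - 1) * b - 2 * (p - 1) = (p - 1) * (a + b - 2) by ring.
  by rewrite mulr_ge0//; lra.
Qed.

Lemma powR_two_point_lt1 p y : 1 < p -> p <= 2 -> 0 <= y -> y < 1 ->
  2 + p * (p - 1) * y ^+ 2 <= (1 + y) `^ p + (1 - y) `^ p.
Proof.
move=> p1 p2 y0 y1; rewrite -subr_ge0.
pose f (x : R) := (1 + x) `^ p + (1 - x) `^ p - (2 + p * (p - 1) * (x * x)).
pose df (x : R) := p * ((1 + x) `^ (p - 1) - (1 - x) `^ (p - 1)
  - 2 * (p - 1) * x).
apply: (@derive_ge0_ge0 f df) => //.
- by rewrite /f addr0 subr0 mulr0 powR1 mulr0 addr0 subrr.
- move=> x /andP[x0 xy].
  have i1 : 0 < 1 + x by lra.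
  have i2 : 0 < 1 - x by lra.
  have g1 : is_derive x 1 (fun z : R => 1 + z) (0 + 1) by exact: is_deriveD.
  have g2 : is_derive x 1 (fun z : R => 1 - z) (0 - 1) by exact: is_deriveB.
  have h1 := @is_derive1_comp _ (fun z => z `^ p) (fun z : R => 1 + z)
    x _ _ (is_derive1_powR _ i1) g1.
  have h2 := @is_derive1_comp _ (fun z => z `^ p) (fun z : R => 1 - z)
    x _ _ (is_derive1_powR _ i2) g2.
  rewrite /f /df; apply: is_derive_eq.
  rewrite /GRing.scale/=; ring.
- move=> x /andP[x0 xy]; rewrite /df.
  have := @powR_add_sub_ge p x p1 p2 x0 (le_lt_trans xy y1).
  by move=> ?; apply: mulr_ge0; lra.
Qed.

Lemma powR_two_point_le1 p y : 1 < p -> p <= 2 -> 0 <= y -> y <= 1 ->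
  2 + p * (p - 1) * y ^+ 2 <= (1 + y) `^ p + (1 - y) `^ p.
Proof.
move=> p1 p2 y0; rewrite le_eqVlt => /predU1P[->|]; last exact: powR_two_point_lt1.
rewrite subrr powR0 ?gt_eqF//; last lra.
apply/ler_addgt0Pl => e e0.
pose t := Num.min (e / 5) 2^-1.
have t0 : 0 < t by rewrite /t lt_min; apply/andP; split; lra.
have te : 5 * t <= e.
  have : t <= e / 5 by rewrite /t ge_min lexx.
  lra.
have t1 : t <= 2^-1 by rewrite /t ge_min lexx orbT.
have y0' : 0 <= 1 - t by lra.
have y1' : 1 - t < 1 by lra.
have := powR_two_point_lt1 p1 p2 y0' y1'.
have -> : 1 - (1 - t) = t by ring.
have : (1 + (1 - t)) `^ p <= (1 + 1) `^ p.
  by apply: ge0_ler_powR; rewrite ?nnegrE; lra.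
have : t `^ p <= t by apply: ge1r_powR; [lra|lra].
have : p * (p - 1) <= 2 by nra.
have : 0 <= p * (p - 1) by nra.
rewrite expr1n expr2.
move: (t `^ p) ((1 + (1 - t)) `^ p) ((1 + 1) `^ p) (p * (p - 1)) => A B C D *.
nra.
Qed.

(** Exchanging a and b when |a| < |b| only enlarges the left side, as p - 1 <= 1. Homogeneity then
    leaves the single variable y = |b|/|a| in [0,1], and Bernoulli's inequality with exponent p/2
    turns the left side into the quadratic already treated. *)
Lemma powR_two_point p a b : 1 < p -> p <= 2 ->
  2 * (a ^+ 2 + (p - 1) * b ^+ 2) `^ (p / 2) <= `|a + b| `^ p + `|a - b| `^ p.
Proof.
move=> p1 p2.
have p0 : 0 < p by lra.
wlog ba : a b / `|b| <= `|a|.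
  move=> hw; have [|/ltW ab] := leP `|b| `|a|; first exact: hw.
  rewrite (addrC a b) (distrC a b); apply: le_trans (hw _ _ ab).
  rewrite ler_pM2l//; apply: ge0_ler_powR; rewrite ?nnegrE; first lra.
  - by rewrite addr_ge0 ?sqr_ge0// mulr_ge0 ?sqr_ge0//; lra.
  - by rewrite addr_ge0 ?sqr_ge0// mulr_ge0 ?sqr_ge0//; lra.
  have : a ^+ 2 <= b ^+ 2.
    by rewrite -(real_normK (num_real a)) -(real_normK (num_real b)) lerXn2r.
  nra.
have [a0|a0] := eqVneq a 0.
  move: ba; rewrite a0 normr0 normr_le0 => /eqP ->.
  rewrite expr0n/= mulr0 addr0 powR0 ?gt_eqF//; last lra.
  by rewrite mulr0 addr_ge0// powR_ge0.
pose y := `|b| / `|a|.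
have na : 0 < `|a| by rewrite normr_gt0.
have y0 : 0 <= y by rewrite divr_ge0.
have y1 : y <= 1 by rewrite ler_pdivrMr// mul1r.
have bE : `|b| = `|a| * y by rewrite /y mulrC divfK// gt_eqF.
have key : `|a + b| `^ p + `|a - b| `^ p
    = (`|a| `^ p) * ((1 + y) `^ p + (1 - y) `^ p).
  have E1 : `|a| * (1 + y) = `|a| + `|b| by rewrite bE; ring.
  have E2 : `|a| * (1 - y) = `|a| - `|b| by rewrite bE; ring.
  rewrite mulrDr -!powRM//; [|lra..].
  rewrite E1 E2.
  have [/= ha|ha] := ger0P a; have [/= hb|hb] := ger0P b.
  - rewrite ger0_norm; [|lra]; rewrite ger0_norm// subr_ge0; move: ba.
    by rewrite !ger0_norm.
  - rewrite addrC opprK; move: ba; rewrite (ger0_norm ha) (ltr0_norm hb) => ?.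
    by congr (_ `^ _ + _ `^ _); rewrite ger0_norm//; lra.
  - move: ba; rewrite (ger0_norm hb) (ltr0_norm ha) => ?.
    rewrite addrC.
    by congr (_ `^ _ + _ `^ _); rewrite ler0_norm; lra.
  - move: ba; rewrite (ltr0_norm hb) (ltr0_norm ha) => ?.
    by congr (_ `^ _ + _ `^ _); rewrite ler0_norm; lra.
rewrite key.
have -> : (a ^+ 2 + (p - 1) * b ^+ 2) `^ (p / 2) =
    `|a| `^ p * (1 + (p - 1) * y ^+ 2) `^ (p / 2).
  rewrite -(real_normK (num_real a)) -(real_normK (num_real b)) bE.
  have -> : `|a| ^+ 2 + (p - 1) * (`|a| * y) ^+ 2 =
    `|a| ^+ 2 * (1 + (p - 1) * y ^+ 2) by ring.
  rewrite powRM ?sqr_ge0//; last by rewrite addr_ge0// mulr_ge0 ?sqr_ge0//; lra.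
  congr (_ * _); rewrite -powR_mulrn// -powRrM; congr (_ `^ _).
  by rewrite mulrC divfK.
rewrite mulrCA ler_pM2l ?powR_gt0//.
apply: le_trans (powR_two_point_le1 p1 p2 y0 y1).
have := @powR_bernoulli (p / 2) ((p - 1) * y ^+ 2).
move=> /(_ _ _)/wrap[].
- by apply/andP; split; lra.
- by rewrite mulr_ge0 ?sqr_ge0//; lra.
lra.
Qed.

(** Hölder's inequality on two points with weights 1 and k and exponents 2/(2-p) and 2/p; the first
    exponent is infinite for p = 2, hence the separate case. Integrated with A and B the p-th
    moments of u and v, it yields the reverse Minkowski inequality for u^2 and v^2 in L_(p/2). *)
Lemma powR_reverse_minkowski p k (a b A B : R) : 1 < p -> p <= 2 -> 0 < k ->
  0 <= A -> 0 <= B ->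
  A `^ (2 / p - 1) * `|a| `^ p + k * B `^ (2 / p - 1) * `|b| `^ p
   <= (A `^ (2 / p) + k * B `^ (2 / p)) `^ (1 - p / 2) *
      (a ^+ 2 + k * b ^+ 2) `^ (p / 2).
Proof.
move=> p1 p2 k0 A0 B0.
have p0 : 0 < p by lra.
have pN : p != 0 by rewrite gt_eqF.
have sqE (x : R) : (`|x| `^ p) `^ (2 / p) = x ^+ 2.
  rewrite -powRrM mulrC divfK// powR_mulrn// real_normK//; exact: num_real.
have [->|pN2] := eqVneq p 2.
  rewrite !divff// !subrr !powRr0 !mul1r mulr1 powRr1; last first.
    by rewrite addr_ge0 ?sqr_ge0// mulr_ge0 ?sqr_ge0// ltW.
  by rewrite !powR_mulrn ?normr_ge0// !real_normK ?num_real.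
have p2' : p < 2 by rewrite lt_neqAle pN2.
have tN : 2 - p != 0 by rewrite gt_eqF//; lra.
pose q := (1 - p / 2)^-1.
have t0 : 0 < 1 - p / 2 by lra.
have q0 : 0 < q by rewrite invr_gt0.
have qi : q^-1 = 1 - p / 2 by rewrite invrK.
have si : (2 / p)^-1 = p / 2 by rewrite invf_div.
have e : (2 / p - 1) * q = 2 / p by rewrite /q; field; rewrite pN/=.
have s0 : 0 < 2 / p by rewrite divr_gt0.
have := @hoelder2 R (A `^ (2 / p - 1)) (k `^ (1 - p / 2) * B `^ (2 / p - 1))
  (`|a| `^ p) (k `^ (p / 2) * `|b| `^ p) q (2 / p).
have kk : k `^ (1 - p / 2) * k `^ (p / 2) = k.
  rewrite -powRD; last by rewrite (gt_eqF k0) implybT.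
  by rewrite subrK powRr1// ltW.
have -> : k `^ (1 - p / 2) * B `^ (2 / p - 1) * (k `^ (p / 2) * `|b| `^ p) =
   (k `^ (1 - p / 2) * k `^ (p / 2)) * B `^ (2 / p - 1) * `|b| `^ p by ring.
rewrite !powRM ?powR_ge0// kk !sqE -!powRrM !e qi si.
have -> : (1 - p / 2) * q = 1 by rewrite /q mulfV// gt_eqF.
have -> : p / 2 * (2 / p) = 1 by field.
rewrite (powRr1 (ltW k0)); apply; rewrite ?mulr_ge0 ?powR_ge0//.
by rewrite subrK.
Qed.

Lemma powR_convex2 s a b : 1 <= s -> 0 <= a -> 0 <= b ->
  2 * ((a + b) / 2) `^ s <= a `^ s + b `^ s.
Proof.
rewrite le_eqVlt => /predU1P[<-|s1] a0 b0.
  by rewrite !powRr1 ?divr_ge0 ?addr_ge0// mulrC divfK.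
set h := (a + b) / 2; have h0 : 0 <= h by rewrite divr_ge0 ?addr_ge0.
have s0 : 0 < s by lra.
have := powR_young s1 a0 h0; have := powR_young s1 b0 h0.
have := mulr_powRB1 h0 s0; have : a + b = 2 * h by rewrite /h; field.
move: (h `^ s) (h `^ (s - 1)) (a `^ s) (b `^ s) => H G X Y abh hH h1 h2.
have : s * (a * G) + s * (b * G) = 2 * s * H.
  by rewrite -mulrDr -mulrDl abh -hH; ring.
lra.
Qed.

Lemma le_of_geometric_le q d : (forall n, q * (1 - 2^-1 ^+ n) <= d) -> q <= d.
Proof.
move=> qd.
have cv : (q * (1 - 2^-1 ^+ n)) @[n --> \oo] --> q * (1 - 0).
  apply: cvgM; first exact: cvg_cst.
  apply: cvgB; first exact: cvg_cst.
  by apply: cvg_expr; rewrite ger0_norm ?invr_ge0// invf_lt1// ltr1n.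
rewrite subr0 mulr1 in cv.
rewrite -(cvg_lim _ cv)//; apply: limr_le; first by apply/cvg_ex; exists q.
exact: nearW.
Qed.

End scalar.

(** * Uniform convexity of L_p *)

Section Lp.
Context {R : realType} {dT : measure_display} {T : measurableType dT}.
Variables (P : probability T R) (p : R).
Implicit Types u v w x y z : T -> R.

Definition in_Lp u := measurable_fun setT u /\
  P.-integrable setT (EFin \o (fun t => `|u t| `^ p)).

Definition moment u := \int[P]_t (`|u t| `^ p).

(** The square of the L_p norm. *)
Definition Lp_sqr u := moment u `^ (2 / p).

Lemma measurable_powR_norm u : measurable_fun setT u ->
  measurable_fun setT (fun t => `|u t| `^ p).
Proof.
move=> mu; have mn : measurable_fun setT (fun t => `|u t|).
  exact: (measurableT_comp (@normr_measurable R setT) mu).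
exact: (measurableT_comp (measurable_powR p) mn).
Qed.

Lemma le_integrableR u v : measurable_fun setT u ->
  (forall t, `|u t| <= `|v t|) -> P.-integrable setT (EFin \o v) ->
  P.-integrable setT (EFin \o u).
Proof.
move=> mu uv; apply: le_integrable => //; first exact/measurable_EFinP.
by move=> t _; rewrite /= lee_fin.
Qed.

Lemma integrableDR u v : P.-integrable setT (EFin \o u) ->
  P.-integrable setT (EFin \o v) ->
  P.-integrable setT (EFin \o (fun t => u t + v t)).
Proof. exact: integrableD. Qed.

Lemma integrableBR u v : P.-integrable setT (EFin \o u) ->
  P.-integrable setT (EFin \o v) ->
  P.-integrable setT (EFin \o (fun t => u t - v t)).
Proof. exact: integrableB. Qed.

Lemma integrableZlR c u : P.-integrable setT (EFin \o u) ->
  P.-integrable setT (EFin \o (fun t => c * u t)).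
Proof. by move=> iu; exact: (integrableZl measurableT c iu). Qed.

Lemma in_LpD u v : 0 <= p -> in_Lp u -> in_Lp v -> in_Lp (fun t => u t + v t).
Proof.
move=> p0 [mu iu] [mv iv]; split; first exact: measurable_funD.
apply: (@le_integrableR _ (fun t => 2 `^ p * (`|u t| `^ p + `|v t| `^ p))).
- by apply: measurable_powR_norm; exact: measurable_funD.
- move=> t; rewrite (ger0_norm (powR_ge0 _ _)).
  rewrite (@ger0_norm _ (2 `^ p * _)) ?mulr_ge0 ?addr_ge0 ?powR_ge0//.
  wlog uv : u v {mu iu mv iv} / `|v t| <= `|u t|.
    move=> hw; have [vu|/ltW uv] := leP `|v t| `|u t|; first exact: hw.
    by rewrite addrC [X in _ * X]addrC; exact: hw.
  apply: (@le_trans _ _ ((2 * `|u t|) `^ p)).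
    apply: (ge0_ler_powR p0); rewrite ?nnegrE ?mulr_ge0//.
    by apply: le_trans (ler_normD _ _) _; lra.
  by rewrite powRM// ler_wpM2l ?powR_ge0// lerDl powR_ge0.
- by have := integrableZlR (2 `^ p) (integrableDR iu iv).
Qed.

Lemma in_LpZ c u : in_Lp u -> in_Lp (fun t => c * u t).
Proof.
move=> [mu iu]; split; first exact: measurable_funM.
rewrite (_ : EFin \o _ = EFin \o (fun t => `|c| `^ p * `|u t| `^ p)).
  exact: integrableZlR.
by apply/funext => t /=; rewrite normrM powRM.
Qed.

Lemma in_LpB u v : 0 <= p -> in_Lp u -> in_Lp v -> in_Lp (fun t => u t - v t).
Proof.
move=> p0 lu lv; have := in_LpD p0 lu (in_LpZ (-1) lv).
by under eq_fun do rewrite mulN1r.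
Qed.

Lemma in_Lp_integrable u : 1 <= p -> in_Lp u -> P.-integrable setT (EFin \o u).
Proof.
move=> p1 [mu iu]; apply: (@le_integrableR _ (fun t => 1 + `|u t| `^ p)) => //.
  move=> t; rewrite (@ger0_norm _ (1 + _)) ?addr_ge0 ?powR_ge0//.
  have [u1|/ltW u1] := leP `|u t| 1.
    by apply: le_trans u1 _; rewrite lerDl powR_ge0.
  by apply: (le_trans (le1r_powR u1 p1)); rewrite lerDr.
apply: integrableDR => //.
exact: (finite_measure_integrable_cst P 1 measurableT).
Qed.

Lemma moment_ge0 u : 0 <= moment u.
Proof. by apply: Rintegral_ge0 => t _; exact: powR_ge0. Qed.

Lemma momentZ c u : in_Lp u -> moment (fun t => c * u t) = `|c| `^ p * moment u.
Proof.
move=> [mu iu]; rewrite /moment -RintegralZl//.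
by apply: eq_Rintegral => t _; rewrite normrM powRM.
Qed.

(* The two-point inequality makes L_p 2-uniformly convex with the sharp constant p - 1 (Ball, Carlen and Lieb). *)
Lemma Lp_sqr_midpoint u v : 1 < p -> p <= 2 -> in_Lp u -> in_Lp v ->
  2 * (Lp_sqr u + (p - 1) * Lp_sqr v) <=
  Lp_sqr (fun t => u t + v t) + Lp_sqr (fun t => u t - v t).
Proof.
move=> p1 p2; have p0 : 0 < p by lra.
have k0 : 0 < p - 1 by lra.
have s0 : 0 < 2 / p by rewrite divr_gt0.
move=> lu lv.
have [mu iu] := lu; have [mv iv] := lv.
have [ma ia] := in_LpD (ltW p0) lu lv; have [mb ib] := in_LpB (ltW p0) lu lv.
have s1 : 1 <= 2 / p by rewrite ler_pdivlMr// mul1r.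
pose A := moment u; pose B := moment v.
pose N := A `^ (2 / p) + (p - 1) * B `^ (2 / p).
pose H := (moment (fun t => u t + v t) + moment (fun t => u t - v t)) / 2.
have A0 : 0 <= A := moment_ge0 u.
have B0 : 0 <= B := moment_ge0 v.
have H0 : 0 <= H by rewrite divr_ge0// addr_ge0 ?moment_ge0.
have N0 : 0 <= N by rewrite addr_ge0 ?powR_ge0// mulr_ge0 ?powR_ge0// ltW.
(* Since A and B are the moments of u and v, the left side of the pointwise Hölder bound integrates
   to N. The factor N^(1-p/2) is constant and is cancelled afterwards, leaving N^(p/2) <= H. *)
have key : N <= N `^ (1 - p / 2) * H.
  have NE : N = \int[P]_t (A `^ (2 / p - 1) * `|u t| `^ p +
      (p - 1) * B `^ (2 / p - 1) * `|v t| `^ p).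
    rewrite RintegralD//; [|exact: integrableZlR..].
    rewrite !RintegralZl// -/(moment u) -/(moment v) -/A -/B.
    by rewrite /N -(mulr_powRB1 A0 s0) -(mulr_powRB1 B0 s0) [A * _]mulrC [B * _]mulrC mulrA.
  have HE : N `^ (1 - p / 2) * H = \int[P]_t (N `^ (1 - p / 2) / 2 *
      (`|u t + v t| `^ p + `|u t - v t| `^ p)).
    rewrite RintegralZl//; last exact: integrableDR.
    by rewrite RintegralD// -mulrA [2^-1 * _]mulrC.
  rewrite HE {1}NE; apply: le_Rintegral => //.
  - by apply: integrableDR; exact: integrableZlR.
  - by apply: integrableZlR; exact: integrableDR.
  move=> t _.
  apply: le_trans (powR_reverse_minkowski (u t) (v t) p1 p2 k0 A0 B0) _.
  rewrite -/N -mulrA ler_wpM2l ?powR_ge0// [leRHS]mulrC ler_pdivlMr// mulrC.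
  exact: powR_two_point.
suff NH : N <= H `^ (2 / p).
  apply: le_trans (powR_convex2 s1 (moment_ge0 _) (moment_ge0 _)).
  by rewrite ler_pM2l.
have [->|NN0] := eqVneq N 0; first exact: powR_ge0.
have N1 : 0 < N by rewrite lt_neqAle eq_sym NN0.
have NE : N = N `^ (1 - p / 2) * N `^ (p / 2).
  by rewrite -powRD ?subrK ?powRr1// NN0 implybT.
have : N `^ (p / 2) <= H by move: key; rewrite {1}NE ler_pM2l// powR_gt0.
move=> /(@ge0_ler_powR _ (2 / p) (ltW s0)) h.
have := h _ _; rewrite -powRrM (_ : p / 2 * (2 / p) = 1) ?powRr1//.
  by apply; rewrite nnegrE// powR_ge0.
by field; rewrite gt_eqF.
Qed.

(* The midpoint inequality is iterated between [x] and [x + 2^-n y]; the remainder [2^n (Lp_sqr (x + 2^-n y) - Lp_sqr x)] is nonnegative by the hypothesis. *)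
Lemma Lp_sqr_orthogonal x y : 1 < p -> p <= 2 -> in_Lp x -> in_Lp y ->
  (forall c, moment x <= moment (fun t => x t + c * y t)) ->
  Lp_sqr x + (p - 1) * Lp_sqr y <= Lp_sqr (fun t => x t + y t).
Proof.
move=> p1 p2 lx ly xy.
have p0 : 0 < p by lra.
have pN : p != 0 by rewrite gt_eqF.
have arith (q e f d d' : R) : f * e = 1 ->
    f * (2 * d' + q * 2^-1 * e ^+ 2) <= f * d ->
    q * (1 - 2^-1 * e) + 2 * f * d' <= q * (1 - e) + f * d.
  move=> fe; have -> : f * (2 * d' + q * 2^-1 * e ^+ 2) =
    2 * f * d' + q * 2^-1 * (f * e) * e by ring.
  by rewrite fe; lra.
pose D n := Lp_sqr (fun t => x t + 2^-1 ^+ n * y t) - Lp_sqr x.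
pose Q := (p - 1) * Lp_sqr y.
have Q0 : 0 <= Q by rewrite mulr_ge0 ?powR_ge0//; lra.
have D0 n : 0 <= D n.
  rewrite subr_ge0; apply: ge0_ler_powR; rewrite ?nnegrE ?moment_ge0//.
  by rewrite divr_ge0// ltW.
(* The midpoint inequality for x + c y and c y, whose sum and difference are x + 2^-n y and x. *)
have step n : 2 * D n.+1 + Q * 2^-1 * (2^-1 ^+ n) ^+ 2 <= D n.
  pose c : R := 2^-1 ^+ n.+1.
  have := @Lp_sqr_midpoint (fun t => x t + c * y t) (fun t => c * y t)
    p1 p2 (in_LpD (ltW p0) lx (in_LpZ c ly)) (in_LpZ c ly).
  have -> : (fun t => x t + c * y t + c * y t) = (fun t => x t + 2^-1 ^+ n * y t).
    by apply/funext => t; rewrite /c exprS; field.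
  have -> : (fun t => x t + c * y t - c * y t) = x.
    by apply/funext => t; ring.
  have -> : Lp_sqr (fun t => c * y t) = c ^+ 2 * Lp_sqr y.
    rewrite /Lp_sqr momentZ// powRM ?powR_ge0 ?moment_ge0// -powRrM.
    have -> : p * (2 / p) = 2 by field.
    by rewrite powR_mulrn// real_normK ?num_real.
  have -> : c ^+ 2 = 2^-1 ^+ 2 * (2^-1 ^+ n) ^+ 2 by rewrite /c (exprS _ n) exprMn.
  rewrite /D -/c /Q; move: (_ ^+ n) => e.
  move: (Lp_sqr _) (Lp_sqr _) (Lp_sqr _) (Lp_sqr _) => X1 X2 X3 X4.
  nra.
(* Multiplied by 2^n, the gain at scale n is Q 2^-(n+1), and these gains add up to Q (1 - 2^-n). *)
have iter n : Q * (1 - 2^-1 ^+ n) + 2 ^+ n * D n <= D 0%N.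
  elim: n => [|n IH]; first by rewrite !expr0 subrr mulr0 add0r mul1r.
  apply: le_trans IH.
  have := ler_wpM2l (exprn_ge0 n (ler0n R 2)) (step n).
  have e1 : 2 ^+ n * (2^-1 ^+ n) = 1 :> R by rewrite -exprMn mulfV ?expr1n.
  rewrite !(exprS _ n); exact: arith.
have DE : D 0%N = Lp_sqr (fun t => x t + y t) - Lp_sqr x.
  by rewrite /D expr0; under eq_fun do rewrite mul1r.
suff : Q <= D 0%N by rewrite DE lerBrDl.
apply: le_of_geometric_le => n.
by apply: le_trans (iter n); rewrite lerDl mulr_ge0// exprn_ge0.
Qed.

End Lp.

(** * Conditional expectations *)

Section sub_sigma_algebra.
Context {R : realType} {dT : measure_display} {T : measurableType dT}.
Variables (P : probability T R) (S : set (set T)).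
Hypothesis mS : S `<=` measurable.
Implicit Types u v w x y z : T -> R.

(** Phrased through preimages, so that [x] remains a function on [T] with its original structure; it
    is the first clause of [is_cond_exp]. *)
Definition sub_measurable x := forall B : set R, measurable B -> <<s S>> (x @^-1` B).

Lemma sigma_sub_measurable : <<s S>> `<=` measurable.
Proof. exact: smallest_sub (@sigma_algebra_measurable _ T) mS. Qed.

Lemma sub_measurable_fun x : sub_measurable x -> measurable_fun setT x.
Proof. by move=> mx _ B mB; rewrite setTI; apply: sigma_sub_measurable; exact: mx. Qed.

Lemma sub_measurable_comp (g : R -> R) x : measurable_fun setT g ->
  sub_measurable x -> sub_measurable (fun t => g (x t)).
Proof.
move=> mg mx B mB; rewrite (_ : _ @^-1` B = x @^-1` (g @^-1` B))//.
by apply: mx; rewrite -[X in measurable X]setTI; exact: mg.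
Qed.

Lemma sub_measurableE x : sub_measurable x <->
  measurable_fun setT (x : g_sigma_algebraType S -> R).
Proof.
split=> [mx _ B mB|mx B mB]; first by rewrite setTI; exact: mx.
by have := mx measurableT B mB; rewrite setTI.
Qed.

Lemma integral_indic_mul A w : measurable A ->
  (\int[P]_t (\1_A t * w t)%:E = \int[P]_(t in A) (w t)%:E)%E.
Proof.
move=> mA; rewrite [RHS]integral_mkcond; apply: eq_integral => t _.
by rewrite patchE indicE; case: (t \in A); rewrite ?mul1r ?mul0r.
Qed.

Import HBNNSimple.

(** [w] is orthogonal to indicators of sets of [<<s S>>], hence to simple functions, hence to [x] by
    dominated convergence with majorant |x w|. The approximation takes place on
    [g_sigma_algebraType S], which puts the level sets into [<<s S>>]. *)
Lemma integral_mul_eq0_nneg x w : sub_measurable x -> (forall t, 0 <= x t) ->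
  P.-integrable setT (EFin \o w) ->
  P.-integrable setT (EFin \o (fun t => x t * w t)) ->
  (forall A, <<s S>> A -> \int[P]_(t in A) (w t)%:E = 0)%E ->
  (\int[P]_t (x t * w t)%:E = 0)%E.
Proof.
move=> mx x0 iw ixw w0.
have mw : measurable_fun setT w by apply/measurable_EFinP; exact: measurable_int iw.
have mx' : measurable_fun setT (EFin \o x : g_sigma_algebraType S -> \bar R).
  exact/measurable_EFinP/sub_measurableE.
pose h := nnsfun_approx measurableT mx'.
have hcv t : h n t @[n --> \oo] --> x t.
  have x0' (r : T) : [set: T] r -> (0 <= (EFin \o x) r)%E by rewrite lee_fin.
  by have /fine_cvgP[] := cvg_nnsfun_approx measurableT mx' x0' (I : [set: T] t).
have hle n t : h n t <= x t.
  rewrite -(cvg_lim _ (hcv t))//; apply: nondecreasing_cvgn_le.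
    by move=> a b ab; have /lefP := nd_nnsfun_approx measurableT mx' ab; exact.
  by apply/cvg_ex; exists (x t).
have mh n : sub_measurable (h n) by apply/sub_measurableE; exact: measurable_funP.
have hw n : (\int[P]_t (h n t * w t)%:E = 0)%E.
  pose A r : set T := h n @^-1` [set r].
  have GA r : <<s S>> (A r) by exact: mh.
  have mA r : dT.-measurable (A r) by exact: sigma_sub_measurable.
  have iA r : P.-integrable setT (fun t => (\1_(A r) t * w t)%:E).
    apply: (le_integrable measurableT _ _ iw).
      by apply/measurable_EFinP; apply: measurable_funM => //.
    move=> t _; rewrite /= lee_fin normrM ler_piMl// indicE.
    by case: (_ \in _); rewrite ?normr1 ?normr0.
  transitivity (\int[P]_t (\sum_(r <- finmap.enum_fset (fset_set (range (h n))))
      (r%:E * (\1_(A r) t * w t)%:E)))%E.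
    apply: eq_integral => t _; rewrite fimfunE fsbig_finite//= mulr_suml -sumEFin.
    by apply: eq_bigr => r _; rewrite -EFinM mulrA.
  rewrite integral_sum//; last by move=> r; exact: integrableZl.
  by rewrite big1// => r _; rewrite integralZl// integral_indic_mul// w0// mule0.
have [] := @dominated_convergence _ _ _ P _ measurableT
  (fun n t => (h n t * w t)%:E) (fun t => (x t * w t)%:E) (fun t => `|x t * w t|%:E).
- move=> n; apply/measurable_EFinP; apply: measurable_funM => //.
  exact: sub_measurable_fun.
- exact: measurable_int ixw.
- by apply: aeW => t _; apply: cvg_EFin; [exact: nearW|apply: cvgM => //; exact: cvg_cst].
- exact: (integrable_norm ixw).
- apply: aeW => t n _; rewrite lee_fin !normrM ler_wpM2r// !ger0_norm//.
move=> _ _; under eq_fun do rewrite hw.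
by move/cvg_lim => <-//; rewrite lim_cst.
Qed.

Lemma integral_mul_eq0 x w : sub_measurable x ->
  P.-integrable setT (EFin \o w) ->
  P.-integrable setT (EFin \o (fun t => x t * w t)) ->
  (forall A, <<s S>> A -> \int[P]_(t in A) (w t)%:E = 0)%E ->
  (\int[P]_t (x t * w t)%:E = 0)%E.
Proof.
move=> mx iw ixw w0.
have mw : measurable_fun setT w by apply/measurable_EFinP; exact: measurable_int iw.
have part (g : R -> R) : measurable_fun setT g -> (forall r, `|g r| <= `|r|) ->
    P.-integrable setT (EFin \o (fun t => g (x t) * w t)).
  move=> mg gr; apply: le_integrableR ixw.
    apply: measurable_funM => //.
    by apply: sub_measurable_fun; exact: sub_measurable_comp.
  by move=> t; rewrite !normrM ler_wpM2r.
have mp : measurable_fun setT (fun r : R => Num.max r 0) by exact: measurable_funrpos.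
have mn : measurable_fun setT (fun r : R => Num.max (- r) 0) by exact: measurable_funrneg.
have ip : P.-integrable setT (EFin \o (fun t => Num.max (x t) 0 * w t)).
  by apply: (part (fun r => Num.max r 0)) => // r; case: (leP r 0) => ?; rewrite ?normr0.
have in_ : P.-integrable setT (EFin \o (fun t => Num.max (- x t) 0 * w t)).
  apply: (part (fun r => Num.max (- r) 0)) => // r.
  by case: (leP (- r) 0) => ?; rewrite ?normr0 ?normrN.
transitivity (\int[P]_t ((Num.max (x t) 0 * w t)%:E - (Num.max (- x t) 0 * w t)%:E))%E.
  apply: eq_integral => t _; rewrite -EFinB -mulrBl; congr (_ * _)%:E.
  by case: (leP (x t) 0) => xt; case: leP => xt'; lra.
rewrite integralB// !integral_mul_eq0_nneg ?sube0//.
- exact: (sub_measurable_comp mn mx).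
- by move=> t; rewrite le_max lexx orbT.
- exact: (sub_measurable_comp mp mx).
- by move=> t; rewrite le_max lexx orbT.
Qed.

End sub_sigma_algebra.

Section conditioning.
Context {R : realType} {dT : measure_display} {T : measurableType dT}.
Variables (P : probability T R) (S : set (set T)).
Hypothesis mS : S `<=` measurable.
Implicit Types u v w x y z : T -> R.

Lemma integrable_bounded_mul (c : R) x y : measurable_fun setT x ->
  (forall t, `|x t| <= c) -> P.-integrable setT (EFin \o y) ->
  P.-integrable setT (EFin \o (fun t => x t * y t)).
Proof.
move=> mx xc iy.
have my : measurable_fun setT y by apply/measurable_EFinP; exact: measurable_int iy.
apply: le_integrableR (integrableZlR c iy); first exact: measurable_funM.
move=> t; rewrite !normrM ler_wpM2r//.
exact: le_trans (xc t) (ler_norm _).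
Qed.

Lemma integrable_bounded (c : R) x : measurable_fun setT x ->
  (forall t, `|x t| <= c) -> P.-integrable setT (EFin \o x).
Proof.
move=> mx xc.
have i1 : P.-integrable setT (EFin \o (fun _ : T => 1 : R)).
  exact: (finite_measure_integrable_cst P 1 measurableT).
have := integrable_bounded_mul mx xc i1.
by under eq_fun do rewrite mulr1.
Qed.

(* Conditional Jensen: [x] is the conditional expectation of [x + y], and [\int x^p] is controlled through the tangent line of [|.|^p] at [x], truncated so as to be integrable. *)
Lemma moment_le_add p x y : 1 < p -> sub_measurable S x ->
  P.-integrable setT (EFin \o y) ->
  (forall A, <<s S>> A -> \int[P]_(t in A) (y t)%:E = 0)%E ->
  in_Lp P p (fun t => x t + y t) ->
  in_Lp P p x /\ moment P p x <= moment P p (fun t => x t + y t).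
Proof.
move=> p1; have p0 : 0 < p by lra.
have q0 : 0 < p - 1 by lra.
move=> sx iy y0 [mxy ixy].
have mx := sub_measurable_fun mS sx.
have my : measurable_fun setT y by apply/measurable_EFinP; exact: measurable_int iy.
pose J (N : nat) : set R := `[- N%:R, N%:R]%classic.
have J_in N (r : R) : (r \in J N) = (`|r| <= N%:R).
  by apply/idP/idP; rewrite inE /J /= in_itv/= ler_norml.
have mJ N : measurable_fun setT (\1_(J N) : R -> R).
  by apply: measurable_indic; exact: measurable_itv.
(* The derivative of |r|^p cut off outside [-N, N]. It is bounded by p N^(p-1), which makes its
   product with [y] integrable. *)
pose psi N (r : R) := \1_(J N) r * (p * (r * `|r| `^ (p - 1 - 1))).
have mpsi N : measurable_fun setT (psi N).
  apply: measurable_funM; first exact: mJ.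
  apply: measurable_funM => //; apply: measurable_funM => //.
  exact: measurable_powR_norm.
have psi_le N (r : R) : `|psi N r| <= p * N%:R `^ (p - 1).
  rewrite /psi indicE J_in; case: (leP `|r| N%:R) => rN; last first.
    by rewrite mul0r normr0 mulr_ge0 ?powR_ge0// ltW.
  rewrite mul1r !normrM (gtr0_norm p0) ler_pM2l// (ger0_norm (powR_ge0 _ _)).
  by rewrite mulr_powRB1//; apply: (ge0_ler_powR (ltW q0)); rewrite ?nnegrE.
pose u N t := \1_(J N) (x t) * `|x t| `^ p.
have mu N : measurable_fun setT (u N).
  apply: measurable_funM; last exact: measurable_powR_norm.
  exact: measurableT_comp (mJ N) mx.
have iu N : P.-integrable setT (EFin \o u N).
  apply: (@integrable_bounded (N%:R `^ p)) => // t.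
  rewrite /u indicE J_in; case: (leP `|x t| N%:R) => rN; last first.
    by rewrite mul0r normr0 powR_ge0.
  rewrite mul1r (ger0_norm (powR_ge0 _ _)).
  by apply: (ge0_ler_powR (ltW p0)); rewrite ?nnegrE.
have ipsi N : P.-integrable setT (EFin \o (fun t => psi N (x t) * y t)).
  by apply: integrable_bounded_mul iy => //; exact: measurableT_comp.
have psi0 N : \int[P]_t (psi N (x t) * y t) = 0.
  rewrite /Rintegral (integral_mul_eq0 mS _ iy (ipsi N) y0)//.
  exact: sub_measurable_comp.
have ule N : \int[P]_t (u N t) <= moment P p (fun t => x t + y t).
  rewrite -[leLHS]addr0 -(psi0 N) -RintegralD//.
  apply: le_Rintegral => //; first exact: integrableDR.
  move=> t _; rewrite /u /psi indicE; case: (_ \in _); last first.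
    by rewrite !mul0r addr0 powR_ge0.
  rewrite !mul1r; apply: le_trans (powR_norm_tangent _ _ p1).
  rewrite lerD2l // -[X in Num.sg _ * X](mulr_powRB1 (normr_ge0 _) q0).
  by rewrite [Num.sg _ * _]mulrA -numEsg.
have u0 N t : 0 <= u N t by rewrite mulr_ge0 ?powR_ge0// indicE.
have limu t : limn (fun N => (u N t)%:E) = (`|x t| `^ p)%:E.
  apply: cvg_lim => //; apply: cvg_EFin; first exact: nearW.
  apply: cvg_near_cst; near=> N.
  rewrite /= /u indicE J_in (_ : `|x t| <= N%:R) ?mul1r//.
  by near: N; exact: nbhs_infty_ger.
(* The bound on the truncated moments is uniform in N, so monotone convergence gives both membership
   of [x] in L_p and the inequality. *)
have cvu : (\int[P]_t (u N t)%:E @[N --> \oo] -->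
    \int[P]_t (`|x t| `^ p)%:E)%E.
  under [X in _ --> X]eq_integral do rewrite -limu.
  apply: (@cvg_monotone_convergence _ _ _ P setT measurableT
    (fun N t => (u N t)%:E)).
  - by move=> N; exact/measurable_EFinP.
  - by move=> N t _; rewrite lee_fin.
  - move=> t _ a b ab; rewrite lee_fin ler_wpM2r ?powR_ge0//.
    rewrite !indicE !J_in ler_nat; case: (leP `|x t| a%:R) => // h.
    by rewrite (le_trans h)// ler_nat.
have intle : (\int[P]_t (`|x t| `^ p)%:E <=
    (moment P p (fun t => (x t + y t)%R))%:E)%E.
  rewrite -(cvg_lim _ cvu)//; apply: lime_le; first by apply/cvg_ex; exists (\int[P]_t (`|x t| `^ p)%:E)%E.
  apply: nearW => N; rewrite -(fineK (integrable_fin_num measurableT (iu N))).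
  by rewrite lee_fin; exact: ule.
have fin : (\int[P]_t (`|x t| `^ p)%:E)%E \is a fin_num.
  rewrite ge0_fin_numE; first exact: le_lt_trans intle (ltry _).
  by apply: integral_ge0 => t _; rewrite lee_fin powR_ge0.
split; last by rewrite -lee_fin fineK.
split => //; apply/integrableP; split.
  by apply/measurable_EFinP; exact: measurable_powR_norm.
under eq_integral do rewrite /= ger0_norm ?powR_ge0//.
by rewrite -ge0_fin_numE// integral_ge0// => t _; rewrite lee_fin powR_ge0.
Unshelve. all: end_near. Qed.

(** By independence 1_A - P(A) integrates to 0 over every set of [<<s S>>], so it is orthogonal to
    [x]. *)
Lemma integral_indep A x : measurable A -> sub_measurable S x ->
  P.-integrable setT (EFin \o x) ->
  (forall B, <<s S>> B -> P (A `&` B) = (P A * P B)%E) ->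
  (\int[P]_(t in A) (x t)%:E = P A * \int[P]_t (x t)%:E)%E.
Proof.
move=> mA sx ix AB.
have mx := sub_measurable_fun mS sx.
pose w t : R := \1_A t - fine (P A).
have PA : (fine (P A))%:E = P A by rewrite fineK// fin_num_measure.
have i1 : P.-integrable setT (EFin \o (\1_A : T -> R)).
  exact: integrable_indic.
have ic (c : R) : P.-integrable setT (EFin \o (fun _ : T => c)).
  exact: (finite_measure_integrable_cst P c measurableT).
have iw : P.-integrable setT (EFin \o w) by exact: integrableBR.
have i1x : P.-integrable setT (EFin \o (fun t => \1_A t * x t)).
  apply: (@integrable_bounded_mul 1) => //.
  by move=> t; rewrite indicE; case: (_ \in _); rewrite ?normr1 ?normr0.
have icx := integrableZlR (fine (P A)) ix.
have ixw : P.-integrable setT (EFin \o (fun t => x t * w t)).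
  rewrite (_ : (fun t => _) = (fun t => \1_A t * x t - fine (P A) * x t)).
    exact: integrableBR.
  by apply/funext => t; rewrite /w; ring.
have w0 B : <<s S>> B -> (\int[P]_(t in B) (w t)%:E = 0)%E.
  move=> GB; have mB := sigma_sub_measurable mS GB.
  under eq_integral do rewrite /w EFinB.
  rewrite integralB//; [|exact: integrableS measurableT mB _ i1|
    exact: integrableS measurableT mB _ (ic _)].
  rewrite integral_indic// integral_cst// [X in (X - _)%E](AB B GB).
  rewrite PA subee// fin_numM//; exact: fin_num_measure.
have := integral_mul_eq0 mS sx iw ixw w0.
under eq_integral do rewrite /w mulrC mulrBl EFinB.
rewrite integralB// integral_indic_mul//.
under [X in (_ - X)%E]eq_integral do rewrite EFinM.
rewrite integralZl// PA => /eqP.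
rewrite sube_eq ?add0e; last 2 first.
- exact: integrable_fin_num (integrableS measurableT mA _ ix).
- by rewrite fin_num_adde_defr// fin_numM ?fin_num_measure// integrable_fin_num.
by move=> /eqP.
Qed.

(** Radon-Nikodym for the charge A -> \int_A Y on [<<s S>>]. The restriction of [P] is encoded as
    its image under the identity map onto [g_sigma_algebraType S]. *)
Lemma cond_exp_exists (Y : T -> R) : P.-integrable setT (EFin \o Y) ->
  exists Z, is_cond_exp P <<s S>> Y Z.
Proof.
move=> iY.
pose T' := g_sigma_algebraType S.
pose phi : T -> T' := id.
have mphi : measurable_fun setT phi.
  by move=> _ B mB; rewrite setTI; apply: (sigma_sub_measurable mS).
pose mf : {mfun T >-> T'} := HB.pack phi (isMeasurableFun.Build _ _ _ _ phi mphi).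
pose Q : probability T' R := distribution P mf.
pose chi := induced_charge iY.
pose nu0 : set T' -> \bar R := fun A => chi A.
have nu00 : nu0 set0 = 0%E by exact: charge0.
have nufin A : measurable A -> nu0 A \is a fin_num.
  by move=> mA; apply: fin_num_measure; apply: (sigma_sub_measurable mS).
have nuadd : semi_sigma_additive nu0.
  move=> F mF tF mUF; apply: charge_semi_sigma_additive => //.
    by move=> n; exact: (sigma_sub_measurable mS (mF n)).
  exact: (sigma_sub_measurable mS mUF).
pose nu : {charge set T' -> \bar R} :=
  HB.pack nu0 (isCharge.Build _ _ _ nu0 nu00 nufin nuadd).
have nuQ : nu `<< Q.
  apply/null_content_dominatesP => A mA QA0.
  have mA' : dT.-measurable (A : set T) by apply: (sigma_sub_measurable mS).
  rewrite /= /nu0 /chi /induced_charge null_set_integral//.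
  by apply: measurable_funTS; exact: measurable_int iY.
have ZE := @Radon_Nikodym_integral _ T' R nu Q _ nuQ.
have Zi := Radon_Nikodym_integrable nuQ.
have Zfin t := Radon_Nikodym_fin_num t nuQ.
set Z0 := Radon_Nikodym nu Q in ZE Zi Zfin.
pose Z (t : T) := fine (Z0 t).
have mZ0 : measurable_fun [set: T'] Z0 by exact: measurable_int Zi.
have mZ : sub_measurable S Z.
  by apply/sub_measurableE; exact: (measurableT_comp (fine_measurable _ ) mZ0).
have EZ : EFin \o Z = Z0 by apply/funext => t; rewrite /= /Z fineK.
have iZ : P.-integrable setT (EFin \o Z).
  apply/integrableP; split.
    by apply/measurable_EFinP; exact: sub_measurable_fun mZ.
  move/integrableP : Zi => [_].
  rewrite ge0_integral_pushforward//.
    by rewrite EZ.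
  exact: measurableT_comp.
exists Z; split => // A GA.
have mA : dT.-measurable A by apply: (sigma_sub_measurable mS).
transitivity (\int[Q]_(x in A) Z0 x)%E; last by rewrite -ZE.
rewrite (integral_pushforward mphi mZ0)//.
  by apply: eq_integral => t _; rewrite /= -EZ.
by rewrite /= -EZ; apply: integrableS iZ.
Qed.

End conditioning.

(** * Numerical bounds for the blocks *)

Lemma card_ord_itv n a b : (b <= n)%N ->
  #|[set i : 'I_n | (a <= i < b)%N]%SET| = (b - a)%N.
Proof.
move=> bn; rewrite -sum1_card.
under eq_bigl do rewrite inE.
rewrite -(big_mkord (fun i => (a <= i < b)%N) (fun=> 1%N)).
rewrite -(big_nat_widen _ _ _ (fun i => a <= i)%N)//.
by rewrite -(big_nat_widenl a 0 b predT)//= sum_nat_const_nat muln1.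
Qed.

Lemma exists_le_average (R : realFieldType) (m : nat) (a : nat -> R) :
  (0 < m)%N -> \sum_(k < m) a k <= 1 -> exists2 k, (k < m)%N & m%:R * a k <= 1.
Proof.
move=> m0 am; apply: contrapT => h.
have m0' : 0 < m%:R :> R by rewrite ltr0n.
have : \sum_(k < m) m%:R^-1 < \sum_(k < m) a k.
  apply: ltr_sum; first by apply/hasP; exists (Ordinal m0); rewrite ?mem_index_enum.
  move=> k _; rewrite -(ltr_pM2l m0') mulfV ?gt_eqF//.
  rewrite ltNge; apply/negP => hk.
  by apply: h; exists (nat_of_ord k); [exact: ltn_ord|exact: hk].
rewrite sumr_const card_ord -[X in X < _]mulr_natl mulfV ?gt_eqF//.
by rewrite ltNge am.
Qed.

(** Take m = floor(1/(4c)) + 1. Then 4cm >= 1, while c <= 1/4 gives 2cm <= 1, so that rounding n/m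
    down costs at most 1 against 2cn. As cn >= 2d >= 2, this loss is absorbed and the block length
    also reaches d. *)
Lemma block_length (R : realType) (c : R) (n d : nat) : 0 < c -> c <= 4^-1 ->
  (0 < d)%N -> 2 * d%:R / c <= n%:R ->
  exists m, [/\ (0 < m)%N, 1 <= 4 * c * m%:R, c * n%:R <= (n %/ m)%:R &
    (d <= n %/ m)%N].
Proof.
move=> c0 c4 d0; rewrite ler_pdivrMr// => nd.
pose x := (4 * c)^-1.
have cx : 4 * c * x = 1 by rewrite /x mulfV// gt_eqF//; lra.
have x0 : 0 <= x by rewrite invr_ge0; lra.
have [lex ltx] := andP (Num.Theory.truncn_itv x0).
exists (Num.truncn x).+1.
set m := (Num.truncn x).+1 in ltx *.
have mx : m%:R <= x + 1 by rewrite /m -natr1; lra.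
have mcx : 2 * c * m%:R <= 1.
  have : c * m%:R <= c * (x + 1) by rewrite ler_pM2l.
  lra.
have d1 : 1 <= d%:R :> R by rewrite ler1n.
have nL : n%:R <= ((n %/ m)%:R + 1) * m%:R :> R.
  by rewrite natr1 -natrM ler_nat ltnW// ltn_ceil.
have cnL : c * n%:R <= (n %/ m)%:R.
  have h1 : 2 * c * n%:R <= 2 * c * (((n %/ m)%:R + 1) * m%:R).
    by rewrite ler_pM2l//; lra.
  have h2 : ((n %/ m)%:R + 1) * (2 * c * m%:R) <= (n %/ m)%:R + 1.
    by rewrite ler_piMr// addr_ge0.
  lra.
split => //.
- have : 4 * c * x <= 4 * c * m%:R by rewrite ler_pM2l ?ltW//; lra.
  lra.
- by rewrite -(ler_nat R); lra.
Qed.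

(** Here [N] is the p-th moment of the increment, [q] is p - 1 and [m] the number of blocks; raising
    the norm bound to the power p/2 turns the exponent 2(p+1)/p into p + 1. *)
Lemma powR_threshold (R : realType) (p eps N q m : R) :
  0 < p -> 0 < eps -> 0 < m -> 0 < q -> 0 <= N ->
  m * (q * N `^ (2 / p)) <= 1 ->
  1 <= 4 * (4^-1 * eps `^ (2 * (p + 1) / p) * q) * m ->
  N <= eps `^ p * eps.
Proof.
move=> p0 e0 m0 q0 N0 h1 h2.
have pN : p != 0 by rewrite gt_eqF.
have NE : N `^ (2 / p) <= eps `^ (2 * (p + 1) / p).
  rewrite -(ler_pM2l (mulr_gt0 m0 q0)); lra.
have hp : 0 <= p / 2 by rewrite divr_ge0// ltW.
have := ge0_ler_powR hp _ _ NE; rewrite !nnegrE !powR_ge0 => /(_ isT isT).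
rewrite -!powRrM (_ : 2 / p * (p / 2) = 1); last by field.
rewrite (powRr1 N0) (_ : 2 * (p + 1) / p * (p / 2) = p + 1); last by field.
by rewrite powRD ?(gt_eqF e0) ?implybT// (powRr1 (ltW e0)).
Qed.

Lemma probability_norm_le (R : realType) (dT : measure_display)
    (T : measurableType dT) (P : probability T R) (p eps : R) (Z : T -> R) :
  0 < p -> 0 < eps -> in_Lp P p Z -> moment P p Z <= eps `^ p * eps ->
  ((1 - eps)%:E <= P [set t | (`|Z t| <= eps)%R])%E.
Proof.
move=> p0 e0 [mZ iZ] hM.
set A := [set t | _].
have mA : measurable A.
  have mn := measurableT_comp (@normr_measurable R setT) mZ.
  have := mn measurableT _ (measurable_itv `]-oo, eps]); rewrite setTI.
  congr (measurable _); apply/seteqP; split=> t; rewrite /A /= in_itv//=.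
have ep0 : 0 < eps `^ p by rewrite powR_gt0.
have hC : eps `^ p * fine (P (~` A)) <= moment P p Z.
  rewrite -(setIT (~` A)) -integral_indic//; last exact: measurableC.
  rewrite -/(Rintegral P setT (\1_(~` A))) -RintegralZl//; last first.
    by apply: integrable_indic => //; exact: measurableC.
  apply: le_Rintegral => //.
    by apply: integrableZlR; apply: integrable_indic => //; exact: measurableC.
  move=> t _; case: (boolP (t \in ~` A)) => tA; last first.
    by rewrite mulr0 powR_ge0.
  rewrite mulr1; apply: (ge0_ler_powR (ltW p0)); rewrite ?nnegrE ?(ltW e0)//.
  by move: tA; rewrite inE /A /= => /negP; rewrite -ltNge => /ltW.
have : fine (P (~` A)) <= eps by rewrite -(ler_pM2l ep0) (le_trans hC).
have PA : P A \is a fin_num by exact: fin_num_measure.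
rewrite probability_setC// fineB//= -[X in (_ <= X)%E]fineK// lee_fin; lra.
Qed.

(** * Martingales and random arrays *)

Section cond_exp_theory.
Context {R : realType} {dT : measure_display} {T : measurableType dT}.
Variables (P : probability T R).
Implicit Types (S : set (set T)) (Y Z : T -> R).

Lemma is_cond_exp_Lp S p Y Z : S `<=` measurable -> 1 < p -> in_Lp P p Y ->
  is_cond_exp P <<s S>> Y Z -> in_Lp P p Z /\ moment P p Z <= moment P p Y.
Proof.
move=> mS p1 lY [mZ iZ ZY].
have iY := in_Lp_integrable (ltW p1) lY.
have YE : (fun t => Z t + (Y t - Z t)) = Y by apply/funext => t; rewrite addrC subrK.
have := @moment_le_add _ _ _ P S mS p Z (fun t => Y t - Z t) p1 mZ
  (integrableBR iY iZ).
rewrite YE; apply=> // A GA.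
have mA := sigma_sub_measurable mS GA.
have sA := fun u => @integrableS _ _ _ P _ A u measurableT mA (@subsetT _ A).
under eq_integral do rewrite EFinB.
rewrite integralB//; [|exact: sA..].
by rewrite ZY// subee//; exact: integrable_fin_num (sA _ iY).
Qed.

(** Both x and z have the integrals of Y over sets of [<<s S>>], so every multiple of z - x
    integrates to 0 there. Conditional Jensen then supplies the minimality of [moment P p x] that
    [Lp_sqr_orthogonal] asks for. *)
Lemma is_cond_exp_increment S (S' : set (set T)) p Y x z : S `<=` measurable ->
  S' `<=` measurable -> <<s S>> `<=` <<s S'>> -> 1 < p -> p <= 2 ->
  in_Lp P p Y -> is_cond_exp P <<s S>> Y x -> is_cond_exp P <<s S'>> Y z ->
  Lp_sqr P p x + (p - 1) * Lp_sqr P p (fun t => z t - x t) <= Lp_sqr P p z.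
Proof.
move=> mS mS' SS' p1 p2 lY xY zY.
have [lx _] := is_cond_exp_Lp mS p1 lY xY.
have [lz _] := is_cond_exp_Lp mS' p1 lY zY.
have p0 : 0 <= p by apply: ltW; exact: lt_trans ltr01 p1.
have ly := in_LpB p0 lz lx.
have zE : (fun t => x t + (z t - x t)) = z by apply/funext => t; rewrite addrC subrK.
have := @Lp_sqr_orthogonal _ _ _ P p x (fun t => z t - x t) p1 p2 lx ly.
rewrite zE; apply => c.
have lcy := in_LpZ c ly.
have iy := in_Lp_integrable (ltW p1) ly.
have icy := in_Lp_integrable (ltW p1) lcy.
have [mx ix xI] := xY; have [mz iz zI] := zY.
have [|//] := @moment_le_add _ _ _ P S mS p x (fun t => c * (z t - x t)) p1 mx icy _
  (in_LpD p0 lx lcy).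
move=> A GA.
have mA := sigma_sub_measurable mS GA.
have sA := fun u => @integrableS _ _ _ P _ A u measurableT mA (@subsetT _ A).
under eq_integral do rewrite EFinM.
rewrite integralZl//; last exact: sA.
under eq_integral do rewrite EFinB.
rewrite integralB//; [|exact: sA..].
rewrite xI// zI//; last exact: SS'.
rewrite subee ?mule0//; apply: integrable_fin_num => //; apply: sA.
exact: in_Lp_integrable (ltW p1) lY.
Qed.

Lemma sum_Lp_sqr_increment_le (S : nat -> set (set T)) (x : nat -> T -> R) p Y m :
  (forall k, S k `<=` measurable) -> (forall k, <<s S k>> `<=` <<s S k.+1>>) ->
  1 < p -> p <= 2 -> in_Lp P p Y ->
  (forall k, is_cond_exp P <<s S k>> Y (x k)) ->
  \sum_(k < m) (p - 1) * Lp_sqr P p (fun t => x k.+1 t - x k t) <= Lp_sqr P p Y.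
Proof.
move=> mS SS p1 p2 lY xY.
have p0 : 0 < p by exact: lt_trans ltr01 p1.
apply: (@le_trans _ _ (Lp_sqr P p (x m))); last first.
  apply: ge0_ler_powR; rewrite ?nnegrE ?moment_ge0//; first by rewrite divr_ge0// ltW.
  by have [] := is_cond_exp_Lp (mS m) p1 lY (xY m).
elim: m => [|m IH]; first by rewrite big_ord0 powR_ge0.
rewrite big_ord_recr/=.
apply: le_trans (is_cond_exp_increment (mS m) (mS m.+1) (SS m) p1 p2 lY (xY m) (xY m.+1)).
by rewrite lerD2r.
Qed.

End cond_exp_theory.

Section arrays.
Context {dT dX : measure_display} {T : measurableType dT} {X : measurableType dX}.
Variables (n d : nat) (Xa : dsub n d -> T -> X).
Hypothesis mXa : forall s, measurable_fun setT (Xa s).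

Definition generators (J : {set 'I_n}) : set (set T) :=
  \bigcup_(s in [set s : dsub n d | val s \subset J])
    preimage_set_system setT (Xa s) measurable.

Lemma sigmaJE J : sigmaJ Xa J = <<s generators J>>.
Proof. by []. Qed.

Lemma generators_measurable J : generators J `<=` measurable.
Proof. by move=> _ [s _ [B mB <-]]; exact: mXa. Qed.

Lemma sigmaJ_subset (J K : {set 'I_n}) : J \subset K -> sigmaJ Xa J `<=` sigmaJ Xa K.
Proof.
move=> JK; apply: sub_sigma_algebra2; move=> A [s /= sJ As].
by exists s => //=; exact: fintype.subset_trans sJ JK.
Qed.

(** The empty set has no d-element subset when d > 0, so there are no generators. This covers the
    first block, where the preceding index set is too small for dissociativity to apply. *)
Lemma sigmaJ0 A : (0 < d)%N -> sigmaJ Xa finset.set0 A -> A = set0 \/ A = setT.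
Proof.
move=> d0; pose trivial := [set B : set T | B = set0 \/ B = setT].
apply: (@smallest_sub _ _ _ trivial) => [|B [s /= s0 _]]; last first.
  move: s0; rewrite finset.subset0 => /eqP s0; have /= := valP s.
  by rewrite s0 finset.cards0 => /eqP d0'; rewrite -d0' in d0.
split.
- by left.
- by move=> B [->|->]; rewrite setTD ?setC0 ?setCT; [right|left].
- move=> F HF; have [[i Fi]|h] := pselect (exists i, F i = setT).
    right; apply/seteqP; split => // t _; exists i => //; by rewrite Fi.
  left; apply/seteqP; split => // t [i _ Fit].
  by have [Fi|Fi] := HF i; [rewrite Fi in Fit|case: h; exists i].
Qed.

Lemma measurable_array_fun (R : realType) (f : (dsub n d -> X) -> R) :
  prod_measurable f -> measurable_fun setT (fun t => f (fun s => Xa s t)).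
Proof.
move=> mf _ B mB; rewrite setTI.
pose F t : dsub n d -> X := fun s => Xa s t.
suff h C : prod_sigma C -> measurable (F @^-1` C) by exact: h (mf B mB).
apply: (smallest_sub (X := [set C | measurable (F @^-1` C)])).
  split => /=.
  - by rewrite preimage_set0.
  - by move=> D mD; rewrite setTD preimage_setC; exact: measurableC.
  - by move=> G mG; rewrite preimage_bigcup; exact: bigcupT_measurable.
move=> D [s _ [B' mB' <-]] /=; rewrite setTI.
by have := mXa s measurableT mB'; rewrite setTI.
Qed.

End arrays.

(** Independence factors the integral as P(A) E[x], and E[x] = E[Y] = 0. *)
Lemma dissociated_integral_eq0 (R : realType) (dT dX : measure_display)
    (T : measurableType dT) (X : measurableType dX) (P : probability T R)
    (n d : nat) (Xa : dsub n d -> T -> X) (J K : {set 'I_n}) (Y x : T -> R) A :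
  (0 < d)%N -> (forall s, measurable_fun setT (Xa s)) -> dissociated P Xa ->
  (forall j k, j \in J -> k \in K -> (j < k)%N) ->
  J = finset.set0 \/ (d <= #|J|)%N -> (d <= #|K|)%N ->
  ('E_P[Y] = 0)%E -> is_cond_exp P (sigmaJ Xa J) Y x -> sigmaJ Xa K A ->
  (\int[P]_(t in A) (x t)%:E = 0)%E.
Proof.
move=> d0 mXa diss JK cJ cK Y0 [mx ix xY] KA.
have mgJ : generators Xa J `<=` measurable by exact: generators_measurable.
have mgK : generators Xa K `<=` measurable by exact: generators_measurable.
have mA := sigma_sub_measurable mgK KA.
rewrite (integral_indep (S := generators Xa J) mgJ mA mx ix).
  have -> : (\int[P]_t (x t)%:E = 0)%E.
    rewrite xY; first by move: Y0; rewrite unlock.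
    have := @sigma_algebraCD _ setT (generators Xa J) _ (@sigma_algebra0 _ setT _).
    by rewrite setD0.
  by rewrite mule0.
move=> B JB; case: cJ => [J0|cJ].
  move: JB; rewrite -sigmaJE J0 => /(sigmaJ0 d0)[->|->].
    by rewrite setI0 measure0 mule0.
  by rewrite setIT probability_setT mule1.
by rewrite setIC muleC; apply: (diss J K).
Qed.

Unset Implicit Arguments.

Theorem theorem7p1 (R : realType) (p eps : R) (n d : nat)
    (dT : measure_display) (T : measurableType dT) (P : probability T R)
    (dX : measure_display) (Xsp : measurableType dX)
    (Xa : dsub n d -> T -> Xsp) (f : (dsub n d -> Xsp) -> R) :
  1 < p -> p <= 2 -> 0 < eps -> eps <= 1 ->
  (0 < n)%N -> (0 < d)%N ->
  let c := 4^-1 * eps `^ (2 * (p + 1) / p) * (p - 1) in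
  2 * d%:R / c <= n%:R ->
  (forall s, measurable_fun setT (Xa s)) ->
  dissociated P Xa ->
  prod_measurable f ->
  let Y := fun t => f (fun s => Xa s t) in
  ('E_P[Y] = 0)%E ->
  ('N[P]_(p%:E)[EFin \o Y] = 1)%E ->
  exists I : {set 'I_n}, nat_interval I /\ c * n%:R <= #|I|%:R /\
    forall J : {set 'I_n}, J \subset I -> (d <= #|J|)%N ->
      forall Z : T -> R, is_cond_exp P (sigmaJ Xa J) Y Z ->
        ((1 - eps)%:E <= P [set t | (`|Z t| <= eps)%R])%E.
Proof.
move=> p1 p2 e0 e1 n0 d0 c.
have p0 : 0 < p by exact: lt_trans ltr01 p1.
have q0 : 0 < p - 1 by rewrite subr_gt0.
have q1 : p - 1 <= 1 by rewrite lerBlDr.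
have c0 : 0 < c by rewrite /c !mulr_gt0// ?invr_gt0 ?powR_gt0.
have c4 : c <= 4^-1.
  rewrite /c -mulrA ler_piMr ?invr_ge0// mulr_ile1 ?powR_ge0 ?(ltW q0)//.
  rewrite -[leRHS](powRr0 eps) (@ger_powR _ eps) ?e0//.
  by rewrite divr_ge0 ?(ltW p0)// mulr_ge0// addr_ge0// ltW.
move=> hn mXa diss mf Y Y0 YN.
have [m [m0 m1 cL dL]] := block_length c0 c4 d0 hn.
set L := (n %/ m)%N in cL dL.
have L0 : (0 < L)%N by exact: leq_trans d0 dL.
have mLn : (m * L <= n)%N by rewrite mulnC leq_trunc_div.
have mY : measurable_fun setT Y by exact: measurable_array_fun.
have YI : (\int[P]_t (`|Y t| `^ p)%:E = 1)%E.
  have := @powR_Lnorm _ _ _ P (EFin \o Y) p (lt0r_neq0 p0).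
  by rewrite YN poweR1r => ->.
have lY : in_Lp P p Y.
  split => //; apply/integrableP; split.
    by apply/measurable_EFinP; exact: measurable_powR_norm.
  under eq_integral do rewrite /= ger0_norm ?powR_ge0//.
  by rewrite YI ltry.
have Y1 : Lp_sqr P p Y = 1.
  by rewrite /Lp_sqr /moment /Rintegral YI powR1.
have iY := in_Lp_integrable (ltW p1) lY.
(* The union of the first k blocks, empty for k = 0. It is defined for every natural k, so that
   [choice] yields a whole sequence [x]. *)
pose J0 k : {set 'I_n} := [set i : 'I_n | (0 <= i < k * L)%N]%SET.
pose S k := generators Xa (J0 k).
have mS k : S k `<=` measurable by exact: generators_measurable.
have SS k : <<s S k>> `<=` <<s S k.+1>>.
  apply: (@sigmaJ_subset _ _ _ _ _ _ Xa); apply/fintype.subsetP => i.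
  rewrite !inE/= => ik; apply: leq_trans ik _.
  by rewrite leq_mul2r leqnSn orbT.
have [x xY] := choice (fun k => cond_exp_exists (mS k) iY).
have := sum_Lp_sqr_increment_le m mS SS p1 p2 lY xY; rewrite Y1.
pose a k := (p - 1) * Lp_sqr P p (fun t => x k.+1 t - x k t).
move=> /(@exists_le_average _ m a m0)[k km hk].
pose y t := x k.+1 t - x k t.
pose I : {set 'I_n} := [set i : 'I_n | (k * L <= i < k.+1 * L)%N]%SET.
have cI : #|I| = L.
  rewrite card_ord_itv; first by rewrite mulSn addnK.
  by apply: leq_trans mLn; rewrite leq_mul2r km orbT.
exists I; split.
  move=> i j l; rewrite !inE => /andP[ki _] /andP[_ lk] ij jl.
  by rewrite (leq_trans ki ij) (leq_ltn_trans jl lk).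
split; first by rewrite cI.
move=> J JI dJ Z ZY.
have JI' i : i \in J -> (k * L <= i < k.+1 * L)%N.
  by move=> /(fintype.subsetP JI); rewrite inE.
have [lx _] := is_cond_exp_Lp (mS k) p1 lY (xY k).
have [lz _] := is_cond_exp_Lp (mS k.+1) p1 lY (xY k.+1).
have ly : in_Lp P p y := in_LpB (ltW p0) lz lx.
have mJ : generators Xa J `<=` measurable by exact: generators_measurable.
(* Over A in F_J the integral of [x k.+1] is that of [Y], because J lies in the first k + 1 blocks,
   and the integral of [x k] vanishes by dissociativity. Hence any version [Z] for [Y] is one for
   the increment. *)
have Zy : is_cond_exp P <<s generators Xa J>> y Z.
  have [mZ iZ ZI] := ZY; split => // A JA; rewrite ZI//.
  have mA := sigma_sub_measurable mJ JA.
  have sA := fun u => @integrableS _ _ _ P _ A u measurableT mA (@subsetT _ A).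
  under [RHS]eq_integral do rewrite /y EFinB.
  rewrite integralB//; [|exact: sA (in_Lp_integrable (ltW p1) lz)|
    exact: sA (in_Lp_integrable (ltW p1) lx)].
  rewrite (@dissociated_integral_eq0 _ _ _ _ _ P _ _ Xa (J0 k) J Y (x k) A)//.
  - rewrite sube0; have [_ _ ->//] := xY k.+1.
    apply: (@sigmaJ_subset _ _ _ _ _ _ Xa J (J0 k.+1)) JA.
    by apply/fintype.subsetP => i /JI' /andP[_ ik]; rewrite inE.
  - move=> j i; rewrite inE/= => jk /JI' /andP[ki _].
    exact: leq_trans jk ki.
  - have [->|k0] := posnP k.
      by left; apply/setP => i; rewrite !inE mul0n ltn0 andbF.
    right; rewrite card_ord_itv ?subn0; last first.
      by apply: leq_trans mLn; rewrite leq_mul2r (ltnW km) orbT.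
    by apply: leq_trans dL _; rewrite leq_pmull.
  - exact: xY.
have [lZ Zle] := is_cond_exp_Lp mJ p1 ly Zy.
apply: (probability_norm_le p0 e0 lZ); apply: le_trans Zle _.
apply: (@powR_threshold _ p eps _ (p - 1) m%:R) => //; first by rewrite ltr0n.
exact: moment_ge0.
Qed.
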